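(* Let $g\ge 1$ and let $(u,B),(u',B') \in (\mathbb{C}^g\times \mathbb{H}_g) \setminus \Theta_g$. Then $X_{(u,B)} \sim X_{(u',B')}$ if and only if $$u = u' + i\left( \tfrac{1}{2}\operatorname{diag}(\beta) + a\right), \qquad B = B' - i\beta$$ for some symmetric $g\times g$ matrix $\beta\in \operatorname{Sym}^2\mathbb{Z}^{g}$ with integer coefficients and some $a\in \mathbb{Z}^g$, where $\operatorname{diag}(\beta)\in\mathbb{Z}^g$ is the diagonal of $\beta$ viewed as a vector.
   Context: Notation: $\mathbf{e}(x)=e^{2\pi x}$. $\mathbb{H}_g=\{B\in\mathbb{C}^{g\times g} : B^t=B,\ \operatorname{Re}B\succ 0\}$. The Riemann theta function is $\theta\colon\mathbb{C}^g\times\mathbb{H}_g\to\mathbb{C}$, $\theta(u,B)=\sum_{n\in\mathbb{Z}^g}\mathbf{e}(-\frac12 n^tBn+n^tu)$, and $\Theta_g=\{(u,B)\in\mathbb{C}^g\times\mathbb{H}_g:\theta(u,B)=0\}$. For $(u,B)\notin\Theta_g$, the (complex) discrete Gaussian distribution with parameters $(u,B)$ is the complex-valued probability distribution on $\mathbb{Z}^g$ given by $p_\theta(n;u,B)=\frac{1}{\theta(u,B)}\mathbf{e}(-\frac12 n^tBn+n^tu)$ (the values sum to $1$); $X_{(u,B)}$ denotes a random variable with values in $\mathbb{Z}^g$ and this distribution. $X\sim Y$ means that $X$ and $Y$ have the same distribution. *)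

(* Defs.v *)
From HB Require Import structures.
From mathcomp Require Import all_boot all_order all_algebra.
From mathcomp Require Import all_classical all_reals all_analysis.
From mathcomp Require Import complex.
From mathcomp Require summability.

Set Implicit Arguments.
Unset Strict Implicit.
Unset Printing Implicit Defensive.

Import Order.TTheory GRing.Theory Num.Theory numFieldNormedType.Exports.

Local Open Scope classical_set_scope.
Local Open Scope ring_scope.
Local Open Scope complex_scope.

Section DiscreteGaussian.
Variable R : realType.
Local Notation C := R[i].

Definition cexp (z : C) : C :=
  (expR (complex.Re z))%:C * (cos (complex.Im z) +i* sin (complex.Im z)).

(* Normalisation: e(x) = exp(2 pi x), without a factor i in the exponent. *)
Definition ebold (x : C) : C := cexp ((2 * pi)%:C * x).

Variable g : nat.

Definition posdefmx (A : 'M[R]_g) : Prop :=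
  forall x : 'cV[R]_g, x != 0 -> 0 < (x^T *m A *m x) 0 0.

(* Siegel space in the "right half-space" convention: Re B is positive
   definite, so that B corresponds to -i tau for tau in the usual Siegel
   upper half-space. *)
Definition siegel : set 'M[C]_g :=
  [set B | B^T = B /\ posdefmx (map_mx (@complex.Re R) B)].

Definition intC {m n : nat} (A : 'M[int]_(m, n)) : 'M[C]_(m, n) :=
  map_mx intr A.

Definition theta_term (u : 'cV[C]_g) (B : 'M[C]_g) (n : 'cV[int]_g) : C :=
  ebold (- 2^-1 * ((intC n)^T *m B *m intC n) 0 0 + ((intC n)^T *m u) 0 0).

(* [summability.sum] is the unconditional sum, i.e., the limit of the sums over
   finite subsets of Z^g ordered by inclusion; the alias [C^o] carries the
   normed module structure of C over itself. *)
Definition theta (u : 'cV[C]_g) (B : 'M[C]_g) : C :=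
  summability.sum (theta_term u B : 'cV[int]_g -> C^o).

Definition theta_locus : set ('cV[C]_g * 'M[C]_g) :=
  [set uB | siegel uB.2 /\ theta uB.1 uB.2 = 0].

(* A complex-valued distribution on Z^g is represented by its mass function
   n |-> P(X = n); this one is the law of X_(u, B). *)
Definition discrete_gaussian (u : 'cV[C]_g) (B : 'M[C]_g)
    (n : 'cV[int]_g) : C :=
  (theta u B)^-1 * theta_term u B n.

Definition mxdiagonal (beta : 'M[int]_g) : 'cV[int]_g := \col_i beta i i.

End DiscreteGaussian.

Arguments siegel : clear implicits.
Arguments theta_locus : clear implicits.
Arguments intC R {m n} A.

(* Main.v *)
(* The value at n = 0 shows that two equal laws have the same normalising
   constant, so equality of laws means that the exponent
   f n = - 1/2 n^T D n + n^T v, with D = B - B' and v = u - u', lies in iZ for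
   every n. The polarisation f (n + m) - f n - f m = - n^T D m at basis vectors
   then gives the entries of D, and f (e_i) those of v. Conversely, for beta
   integral and symmetric, n^T beta n + n^T diag beta is even because its
   off-diagonal terms come in equal pairs and n_i (n_i + 1) is even. *)

Require Import Defs.
From HB Require Import structures.
From mathcomp Require Import all_boot all_order all_algebra.
From mathcomp Require Import all_classical all_reals all_analysis.
From mathcomp Require Import complex.
From mathcomp Require Import ring lra.

Import Order.TTheory GRing.Theory Num.Theory numFieldNormedType.Exports.

Local Open Scope classical_set_scope.
Local Open Scope ring_scope.
Local Open Scope complex_scope.

Lemma cos_periodz (R : realType) (x : R) (k : int) :
  cos (x + 2 * pi * k%:~R) = cos x.
Proof.
have E (y : R) (n : nat) : cos (y + 2 * pi * n%:R) = cos y.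
  rewrite mulr_natr mulr_natl; exact: (periodicn (@cosD2pi R)).
case: k => n; first exact: E.
rewrite NegzE rmorphN /= mulrN -[in RHS](subrK (2 * pi * n.+1%:R) x) E //.
Qed.

Lemma sin_periodz (R : realType) (x : R) (k : int) :
  sin (x + 2 * pi * k%:~R) = sin x.
Proof. by rewrite -!cosBpihalf addrAC cos_periodz. Qed.

(** Subtracting a multiple of [2 * pi] found by the floor leaves [2 z] with [z] in [0, pi). The
    double-angle formula turns cos (2 z) = 1 into sin z = 0, and the sine is positive on (0, pi), so
    [z] vanishes. *)
Lemma cos_eq1 (R : realType) (x : R) :
  cos x = 1 <-> exists k : int, x = 2 * pi * k%:~R.
Proof.
have pi0 := pi_gt0 R.
split=> [cx1|[k ->]]; last by rewrite -[_ * _]add0r cos_periodz cos0.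
exists (Num.floor (x / (2 * pi))); set k := Num.floor _.
have := floor_itv (x / (2 * pi)); rewrite -/k => /andP[kx].
rewrite intrD mulr1z ltr_pdivrMr ?mulr_gt0// => xk.
move: kx; rewrite ler_pdivlMr ?mulr_gt0// => kx.
pose z := (x - 2 * pi * k%:~R) / 2.
have xE : x = z *+ 2 + 2 * pi * k%:~R by rewrite /z -mulr_natr; field.
have sz0 : sin z = 0.
  apply/eqP; rewrite -sqrf_eq0 sin2cos2; apply/eqP.
  by move: cx1; rewrite xE cos_periodz cos_mulr2n -mulr_natr; lra.
have [zp|zn] := ltP 0 z; last by rewrite /z in zn; lra.
have : 0 < sin z by apply: sin_gt0_pi; rewrite zp /= /z; lra.
by rewrite sz0 ltxx.
Qed.

Lemma eboldD (R : realType) (x y : R[i]) : ebold (x + y) = ebold x * ebold y.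
Proof.
case: x y => [a b] [c d]; rewrite /ebold /cexp /=; simpc.
rewrite mulrDr expRD [2 * pi * (b + d)]mulrDr cosD sinD.
by apply/eqP; rewrite eq_complex /=; apply/andP; split; apply/eqP; ring.
Qed.

Lemma ebold0 (R : realType) : ebold (0 : R[i]) = 1.
Proof. by rewrite /ebold /cexp mulr0 /= expR0 cos0 sin0 mul1r. Qed.

Lemma ebold_neq0 (R : realType) (x : R[i]) : ebold x != 0.
Proof.
apply/eqP => x0; have := ebold0 R.
by rewrite -(subrr x) eboldD x0 mul0r => /eqP; rewrite eq_sym oner_eq0.
Qed.

(** Since [ebold] has no factor i in its exponent, its periods lie on the imaginary axis. This is
    the source of every factor i in the theorem. *)
Lemma ebold_eq1 (R : realType) (x : R[i]) :
  ebold x = 1 <-> exists k : int, x = 'i%C * k%:~R.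
Proof.
have intE (k : int) : k%:~R = (k%:~R)%:C :> R[i] by rewrite rmorph_int.
case: x => [a b]; rewrite /ebold /cexp /=; simpc; split; last first.
  case=> k; rewrite intE; simpc => -[-> ->].
  rewrite mulr0 expR0 !mul1r -[2 * pi * _]add0r cos_periodz sin_periodz.
  by rewrite cos0 sin0.
have epos := expR_gt0 (2 * pi * a).
case=> rc /eqP; rewrite mulf_eq0 (gt_eqF epos) /= => /eqP s0.
have a0 : a = 0.
  have := cos2Dsin2 (2 * pi * b); rewrite s0 expr0n addr0 => /eqP.
  (* A vanishing sine leaves cosine 1 or -1; the value -1 would make the real part negative instead
     of 1. *)
  rewrite sqrf_eq1 => /orP[] /eqP c1; last by move: rc epos; rewrite c1; lra.
  move: rc; rewrite c1 mulr1 -[in RHS](@expR0 R) => /expR_inj /eqP.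
  by rewrite !mulf_eq0 pnatr_eq0 (gt_eqF (pi_gt0 R)) => /eqP.
move: rc; rewrite a0 mulr0 expR0 mul1r => /cos_eq1[k /mulfI bk].
exists k; rewrite intE; simpc; rewrite bk//.
by rewrite mulf_neq0 ?pnatr_eq0 ?gt_eqF ?pi_gt0.
Qed.

(** Isolated from [theta_term] because it is linear in the pair (u, B): a quotient of two terms
    becomes [ebold] of the exponent at the difference of parameters, even though B - B' may leave
    the Siegel space. *)
Definition theta_exponent {R : realType} {g : nat} (u : 'cV[R[i]]_g)
    (B : 'M[R[i]]_g) (n : 'cV[int]_g) : R[i] :=
  - 2^-1 * ((intC R n)^T *m B *m intC R n) 0 0 + ((intC R n)^T *m u) 0 0.

Section Exponent.
Context {R : realType} {g : nat}.
Implicit Types (u v : 'cV[R[i]]_g) (B D : 'M[R[i]]_g) (n m a : 'cV[int]_g).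

Lemma theta_exponentB u u' B B' n :
  theta_exponent (u - u') (B - B') n =
  theta_exponent u B n - theta_exponent u' B' n.
Proof.
have subE (p q : 'M[R[i]]_1) : (p - q) 0 0 = p 0 0 - q 0 0 by rewrite !mxE.
by rewrite /theta_exponent !mulmxBr mulmxBl !subE; ring.
Qed.

(** The linear part cancels, and symmetry of [D] makes the two cross terms equal, which absorbs the
    factor 1/2. *)
Lemma theta_exponent_polar v D n m : D^T = D ->
  theta_exponent v D (n + m) - theta_exponent v D n - theta_exponent v D m =
  - ((intC R n)^T *m D *m intC R m) 0 0.
Proof.
move=> Dsym; rewrite /theta_exponent.
have symE : ((intC R m)^T *m D *m intC R n) 0 0 =
            ((intC R n)^T *m D *m intC R m) 0 0.
  rewrite -[in RHS](trmxK (_ *m D *m intC R m)) [in RHS]mxE.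
  by rewrite !trmx_mul trmxK Dsym mulmxA.
have addE (p q : 'M[R[i]]_1) : (p + q) 0 0 = p 0 0 + q 0 0 by rewrite !mxE.
have -> : intC R (n + m) = intC R n + intC R m by rewrite /intC map_mxD.
by rewrite [(_ + _)^T]linearD /= !(mulmxDl, mulmxDr) !addE symE; field.
Qed.

Lemma delta_quadratic D i j :
  ((intC R (delta_mx i 0 : 'cV_g))^T *m D *m intC R (delta_mx j 0 : 'cV_g)) 0 0 = D i j.
Proof.
by rewrite /intC !map_delta_mx /= trmx_delta -rowE -colE !mxE.
Qed.

Lemma theta_exponent_delta v D i :
  theta_exponent v D (delta_mx i 0) = - 2^-1 * D i i + v i 0.
Proof.
rewrite /theta_exponent delta_quadratic; congr (_ + _).
by rewrite /intC !map_delta_mx /= trmx_delta -rowE mxE.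
Qed.

End Exponent.

Lemma symmetric_quadratic_even (g : nat) (beta : 'M[int]_g) (n : 'cV[int]_g) :
  beta^T = beta ->
  exists k : int,
    (n^T *m beta *m n) 0 0 + (n^T *m mxdiagonal beta) 0 0 = 2 * k.
Proof.
move=> bsym.
have even_mulS (x : int) : exists k : int, x * (x + 1) = 2 * k.
  elim/int_ind: x => [|m [k kE]|m [k kE]]; first by exists 0.
    by exists (k + m.+1%:Z); rewrite [RHS]mulrDr -kE -addn1 PoszD; ring.
  by exists (k + m%:Z); rewrite [RHS]mulrDr -kE -addn1 PoszD; ring.
have [f fE] := choice even_mulS.
pose F i j := n i 0 * beta i j * n j 0.
have FC i j : F i j = F j i by rewrite /F -[in LHS]bsym mxE; ring.
(* Half of the total: [f] halves n_i (n_i + 1) on the diagonal, and each off-diagonal pair is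
   counted once. *)
exists (\sum_i beta i i * f (n i 0) + \sum_(i < g) \sum_(j < g | (i < j)%N) F i j).
have -> : (n^T *m beta *m n) 0 0 = \sum_i \sum_j F i j.
  rewrite -mulmxA mxE; apply: eq_bigr => i _; rewrite !mxE mulr_sumr.
  by apply: eq_bigr => j _; rewrite /F mulrA.
have -> : \sum_i \sum_j F i j =
    \sum_i F i i + 2 * \sum_(i < g) \sum_(j < g | (i < j)%N) F i j.
  rewrite mulr2n mulrDl mul1r.
  (* One copy of the upper triangle is summed by columns; by [FC] it becomes the lower triangle, so
     that each row splits into j = i, j < i and j > i. *)
  rewrite [X in _ = _ + (X + _)](exchange_big_dep predT) //= -!big_split /=.
  apply: eq_bigr => i _.
  rewrite (bigD1 i) //=; congr (_ + _).
  rewrite (bigID (fun j : 'I_g => (j < i)%N)) /=; congr (_ + _).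
    by apply: eq_big => [j|j _]; rewrite ?(FC i j)// -val_eqE /=; case: ltngtP.
  by apply: eq_bigl => j; rewrite -val_eqE /=; case: ltngtP.
rewrite addrAC mulrDr; congr (_ + _).
rewrite mxE -big_split mulr_sumr; apply: eq_bigr => i _ /=.
by rewrite !mxE mulrCA -fE /F; ring.
Qed.

Lemma theta_exponent_lattice (R : realType) (g : nat) (v : 'cV[R[i]]_g)
    (D : 'M[R[i]]_g) :
  D^T = D ->
  (forall n, exists k : int, theta_exponent v D n = 'i%C * k%:~R) <->
  exists (beta : 'M[int]_g) (a : 'cV[int]_g),
    [/\ beta^T = beta,
        v = 'i%C *: (2^-1 *: intC R (mxdiagonal beta) + intC R a)
      & D = - ('i%C *: intC R beta)].
Proof.
move=> Dsym; split=> [/choice[K KE]|[beta [a [bsym -> ->]]] n].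
  pose e i : 'cV[int]_g := delta_mx i 0.
  have [beta betaE] : exists beta : 'M[int]_g,
      forall i j, beta i j = K (e i + e j) - K (e i) - K (e j).
    exists (\matrix_(i, j) (K (e i + e j) - K (e i) - K (e j))) => i j.
    by rewrite mxE.
  have DE i j : D i j = - ('i%C * (beta i j)%:~R).
    apply: oppr_inj; rewrite -delta_quadratic -(theta_exponent_polar v)//.
    by rewrite !KE betaE !rmorphB /=; ring.
  (* At e_i the exponent gives v_i = i (K(e_i) - beta_ii / 2). Writing -1/2 as 1/2 - 1 produces the
     half diagonal with a plus sign and leaves this integer as a_i. *)
  exists beta, (\col_i (K (e i) - beta i i)); split.
  - by apply/matrixP=> i j; rewrite mxE !betaE addrC (addrC (e j)); ring.
  - apply/colP=> i.
    have := KE (e i); rewrite theta_exponent_delta DE.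
    rewrite !mxE rmorphB /= => vE.
    by rewrite mulrDr mulrBr -vE; field.
  - by apply/matrixP=> i j; rewrite DE !mxE.
have [k kE] := symmetric_quadratic_even _ _ n bsym.
exists (k + (n^T *m a) 0 0).
have intM p q r (M : 'M[int]_(p, q)) (N : 'M[int]_(q, r)) :
  intC R M *m intC R N = intC R (M *m N) by rewrite /intC map_mxM.
have -> : theta_exponent ('i%C *: (2^-1 *: intC R (mxdiagonal beta) + intC R a))
    (- ('i%C *: intC R beta)) n =
  'i%C * (2^-1 * ((n^T *m beta *m n) 0 0 + (n^T *m mxdiagonal beta) 0 0)%:~R
          + ((n^T *m a) 0 0)%:~R).
  rewrite /theta_exponent; have -> : (intC R n)^T = intC R n^T by rewrite /intC map_trmx.
  rewrite mulmxN mulNmx -!(scalemxAr, scalemxAl) mulmxDr -scalemxAr !intM.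
  rewrite /intC !mxE rmorphD /=; ring.
by rewrite kE rmorphM rmorphD /=; field.
Qed.

Theorem proposition3p3 (R : realType) (g : nat) (hg : (1 <= g)%N)
  (u u' : 'cV[R[i]]_g) (B B' : 'M[R[i]]_g)
  (huB : (([set: 'cV[R[i]]_g] `*` siegel R g)
            `\` theta_locus R g) (u, B))
  (huB' : (([set: 'cV[R[i]]_g] `*` siegel R g)
            `\` theta_locus R g) (u', B')) :
  discrete_gaussian u B =1 discrete_gaussian u' B' <->
  exists (beta : 'M[int]_g) (a : 'cV[int]_g),
    [/\ beta^T = beta,
        u = u' + 'i%C *: (2^-1 *: intC R (mxdiagonal beta) + intC R a)
      & B = B' - 'i%C *: intC R beta].
Proof.
case: huB huB' => [[_ /= hB] nuB] [[_ /= hB'] _].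
have th0 : theta u B != 0 by apply/eqP => th0; apply: nuB.
have Dsym : (B - B')^T = B - B' by rewrite linearB /= hB.1 hB'.1.
have termE : theta_term u B =1 theta_term u' B' <->
    forall n, exists k : int, theta_exponent (u - u') (B - B') n = 'i%C * k%:~R.
  split=> [eqt n|lat n].
    apply/ebold_eq1; rewrite theta_exponentB.
    (* Multiplying by the nonzero second term turns the claim that the quotient is 1 into the
       equality of the two terms. *)
    apply: (mulIf (ebold_neq0 _ (theta_exponent u' B' n))).
    by rewrite -eboldD subrK mul1r; exact: eqt.
  rewrite -[LHS]/(ebold (theta_exponent u B n)).
  rewrite -(subrK (theta_exponent u' B' n) (theta_exponent u B n)) eboldD.
  by rewrite -theta_exponentB (ebold_eq1 _ _).2 // mul1r.
apply: (@iff_trans _ (theta_term u B =1 theta_term u' B')).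
  split=> [eqp n|eqt n]; last first.
    (* The normalising constant depends only on the family of terms, so it agrees as well. *)
    by rewrite /discrete_gaussian /theta (funext eqt).
  have term0 w A : theta_term w A 0 = 1 :> R[i].
    by rewrite /theta_term /intC map_mx0 trmx0 !mul0mx !mxE mulr0 addr0 ebold0.
  have := eqp 0; rewrite /discrete_gaussian !term0 !mulr1 => thE.
  have := eqp n; rewrite /discrete_gaussian -thE; apply: mulfI.
  by rewrite invr_eq0.
apply: (iff_trans termE); apply: (iff_trans (theta_exponent_lattice _ _ _ _ Dsym)).
split=> -[beta [a [bsym uE BE]]]; exists beta, a; split=> //.
- by rewrite -uE addrC subrK.
- by rewrite -BE addrC subrK.
- by rewrite uE addrAC subrr add0r.
- by rewrite BE addrAC subrr add0r.
Qed.
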